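(* Let $K$ be a $\Delta$-$\sigma$-field and let $R=K\{y_1,\dots,y_n\}$ be the ring of $\Delta$-$\sigma$-polynomials over $K$. Then $R$ satisfies the ascending chain condition for prime $\Delta$-$\sigma$-ideals: for every ascending chain $P_1\subseteq P_2\subseteq\cdots$ of prime $\Delta$-$\sigma$-ideals of $R$ there exists $j\ge 1$ such that $P_j=P_{j+1}=\cdots$. In particular (the case $\Delta=\emptyset$), the ring of difference polynomials $K\{y_1,\dots,y_n\}$ over an ordinary difference field $K$ satisfies the ascending chain condition for prime difference ideals.
   Context: $\mathbb{N}$ denotes the non-negative integers. All fields have characteristic zero. A $\Delta$-$\sigma$-ring (difference-differential ring with one translation) is a commutative ring with unity together with a finite set $\Delta=\{\delta_1,\dots,\delta_m\}$ of derivations and an injective ring endomorphism $\sigma$, such that any two of the maps in $\Delta\cup\{\sigma\}$ commute; a $\Delta$-$\sigma$-field is such a ring that is a field. When $\Delta=\emptyset$ one speaks of (ordinary) difference rings, difference fields, difference ideals and difference polynomials. $T$ is the free commutative semigroup of all power products $\delta_1^{k_1}\cdots\delta_m^{k_m}\sigma^l$ ($k_i,l\in\mathbb{N}$). The ring of $\Delta$-$\sigma$-polynomials $K\{y_1,\dots,y_n\}$ is the polynomial ring over $K$ in the indeterminates $\tau y_j$ ($\tau\in T$, $1\le j\le n$), made into a $\Delta$-$\sigma$-ring by $\alpha(\tau y_j)=(\alpha\tau)y_j$ for $\alpha\in\Delta\cup\{\sigma\}$ and by letting $\Delta\cup\{\sigma\}$ act on coefficients as on $K$. A $\Delta$-$\sigma$-ideal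 is an ideal closed under all maps of $\Delta\cup\{\sigma\}$; it is called prime if it is a prime ideal (it is not required to be reflexive, i.e. $\sigma(a)\in P$ need not imply $a\in P$). *)

(* Defs.v *)
From HB Require Import structures.
From mathcomp Require Import all_boot all_order all_algebra.
From mathcomp Require Import ring finmap.
From mathcomp Require Import boolp classical_sets.
From mathcomp.multinomials Require Import monalg.

Set Implicit Arguments.
Unset Strict Implicit.
Unset Printing Implicit Defensive.

Import GRing.Theory.

Local Open Scope ring_scope.

Local Notation "1" := (@mone _) : monom_scope.
Local Notation "x * y" := (mmul x y) : monom_scope.

(* The derivations form a family indexed by 'I_m: two of them may act
   identically on R and still be distinct generators of the semigroup dsop. *)
HB.mixin Record ComNzRing_isDSRing (m : nat) R of GRing.ComNzRing R := {
  ds_delta : 'I_m -> {additive R -> R};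
  ds_sigma : {rmorphism R -> R};
  ds_deltaM : forall i x y,
    ds_delta i (x * y) = ds_delta i x * y + x * ds_delta i y;
  ds_sigma_inj : injective ds_sigma;
  ds_deltaC : forall i j x,
    ds_delta i (ds_delta j x) = ds_delta j (ds_delta i x);
  ds_delta_sigmaC : forall i x,
    ds_delta i (ds_sigma x) = ds_sigma (ds_delta i x)
}.

#[short(type="dsRingType")]
HB.structure Definition DSRing (m : nat) :=
  { R of GRing.ComNzRing R & ComNzRing_isDSRing m R }.

#[short(type="dsFieldType")]
HB.structure Definition DSField (m : nat) :=
  { K of GRing.Field K & ComNzRing_isDSRing m K }.

Notation diffFieldType := (dsFieldType 0).

Arguments ds_delta {m s} i.
Arguments ds_sigma {m s}.

Section Ideals.
Local Open Scope classical_set_scope.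

Record is_ideal (R : comNzRingType) (P : set R) : Prop := IsIdeal {
  ideal0 : P 0;
  idealD : forall x y, P x -> P y -> P (x + y);
  idealMl : forall a x, P x -> P (a * x)
}.

Record is_prime_ideal (R : comNzRingType) (P : set R) : Prop := IsPrimeIdeal {
  prime_ideal_ideal : is_ideal P;
  prime_ideal_proper : ~ P 1;
  prime_idealM : forall x y, P (x * y) -> P x \/ P y
}.

Record is_ds_ideal (m : nat) (R : dsRingType m) (P : set R) : Prop :=
  IsDSIdeal {
    ds_ideal_ideal : is_ideal P;
    ds_ideal_delta : forall i x, P x -> P (ds_delta i x);
    ds_ideal_sigma : forall x, P x -> P (ds_sigma x)
  }.

Definition is_prime_ds_ideal (m : nat) (R : dsRingType m) (P : set R) : Prop :=
  is_ds_ideal P /\ is_prime_ideal P.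

End Ideals.

Lemma comm_addD (A : zmodType) (D D' : {additive A -> A}) x y :
  D (D' x) = D' (D x) -> D (D' y) = D' (D y) -> D (D' (x + y)) = D' (D (x + y)).
Proof. by move=> ex ey; rewrite !raddfD ex ey. Qed.

Section Leibniz.
Variables (A : comNzRingType) (D : {additive A -> A}).
Local Notation leibniz x y := (D (x * y) = D x * y + x * D y).

Lemma leibniz0l y : leibniz 0 y.
Proof. by rewrite mul0r !raddf0 !mul0r addr0. Qed.

Lemma leibniz0r x : leibniz x 0.
Proof. by rewrite mulr0 !raddf0 !mulr0 addr0. Qed.

Lemma leibnizDl x x' y : leibniz x y -> leibniz x' y -> leibniz (x + x') y.
Proof. by move=> ex ex'; rewrite mulrDl !raddfD ex ex' !mulrDl addrACA. Qed.

Lemma leibnizDr x y y' : leibniz x y -> leibniz x y' -> leibniz x (y + y').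
Proof. by move=> ey ey'; rewrite mulrDr !raddfD ey ey' !mulrDr addrACA. Qed.

Lemma leibniz_prod (a b da db u v du dv : A) :
  (da * b + a * db) * (u * v) + a * b * (du * v + u * dv) =
  (da * u + a * du) * (b * v) + a * u * (db * v + b * dv).
Proof. by ring. Qed.

Hypothesis DM : forall x y, leibniz x y.

Lemma leibniz1 : D 1 = 0.
Proof.
move: (DM 1 1); rewrite !mulr1 mul1r => /esym/(canRL (addrK _)).
by rewrite subrr.
Qed.

Lemma leibniz_commM (D' : {additive A -> A}) x y :
  (forall u v, D' (u * v) = D' u * v + u * D' v) ->
  D (D' x) = D' (D x) -> D (D' y) = D' (D y) -> D (D' (x * y)) = D' (D (x * y)).
Proof.
move=> D'M ex ey; rewrite D'M DM !raddfD /= !DM !D'M ex ey.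
by ring.
Qed.

Lemma leibniz_rmorphM (s : {rmorphism A -> A}) x y :
  D (s x) = s (D x) -> D (s y) = s (D y) -> D (s (x * y)) = s (D (x * y)).
Proof. by move=> ex ey; rewrite rmorphM !DM rmorphD !rmorphM ex ey. Qed.

End Leibniz.

Section MalgInd.
Variables (I : choiceType) (R : comNzRingType).
Local Notation A := {malg R[{cmonom I}]}.

Lemma malgUM a b (k l : {cmonom I}) :
  << a *g k >> * << b *g l >> = << a * b *g k * l >> :> A.
Proof. exact: fgmulUU. Qed.

Lemma malgX_M (k l : {cmonom I}) : << k * l >> = << k >> * << l >> :> A.
Proof. by rewrite malgUM mulr1. Qed.

Lemma malgU_C a (k : {cmonom I}) : << a *g k >> = a%:MP * << k >> :> A.
Proof. by rewrite malgUM mulr1 mul1m. Qed.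

Lemma malgU_ind (P : A -> Prop) :
  P 0 -> (forall p q, P p -> P q -> P (p + q)) ->
  (forall a k, P << a *g k >>) -> forall p, P p.
Proof.
move=> P0 PD PU p; rewrite [p]monalgE.
by apply: (big_ind P) => [//|//|k _]; apply: PU.
Qed.

Lemma malgU_inj (k l : {cmonom I}) : << k >> = << l >> :> A -> k = l.
Proof.
move=> kl; have lk1: (l == k)%:R = 1 :> R.
  by rewrite -mcoeffU1 -kl mcoeffU1 eqxx.
move: lk1; clear kl; case: eqVneq => // _ /eqP.
by rewrite eq_sym oner_eq0.
Qed.

Lemma malgU_prod (f : I -> I) (k : {cmonom I}) : injective f ->
  exists2 q : {cmonom I},
    \prod_(v <- finsupp k) << ucm (f v) >> ^+ k v = << q >> :> A &
    forall v, q (f v) = k v.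
Proof.
move=> f_inj.
have powE (v : I) e : exists2 q : {cmonom I},
    << ucm v >> ^+ e = << q >> :> A & forall i, q i = (e * (v == i))%N.
  elim: e => [|e [q qE q_i]].
    by exists 1%M => [|i]; rewrite ?expr0 // cm1.
  exists (ucm v * q)%M => [|i]; last by rewrite cmM cmU q_i mulSn.
  by rewrite exprS qE malgUM mulr1; reflexivity.
have prodE (r : seq I) : uniq r -> exists2 q : {cmonom I},
    \prod_(v <- r) << ucm (f v) >> ^+ k v = << q >> :> A &
    forall i, q (f i) = (if i \in r then k i else 0)%N.
  elim: r => [|v r IHr] /=; first by exists 1%M => [|i]; rewrite ?big_nil ?cm1.
  move=> /andP[vNr /IHr[q qE q_i]]; have [u uE u_i] := powE (f v) (k v).
  exists (u * q)%M => [|i].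
    by rewrite big_cons qE uE malgUM mulr1; reflexivity.
  rewrite cmM u_i q_i inE (inj_eq f_inj) eq_sym; case: eqVneq => [->|_].
    by rewrite (negbTE vNr) muln1 addn0.
  by rewrite muln0.
have [q qE q_i] := prodE _ (fset_uniq (finsupp k)).
by exists q => // i; rewrite q_i; case: finsuppP.
Qed.

Lemma malgX_prod (k : {cmonom I}) :
  << k >> = \prod_(v <- finsupp k) << ucm v >> ^+ k v :> A.
Proof.
have [q -> q_i] := malgU_prod k (@inj_id I).
by congr << _ >>; apply/eqP/cmP => i; exact: (esym (q_i i)).
Qed.

Lemma malg_ind (P : A -> Prop) :
  (forall c, P c%:MP) -> (forall v, P << ucm v >>) ->
  (forall p q, P p -> P q -> P (p + q)) ->
  (forall p q, P p -> P q -> P (p * q)) -> forall p, P p.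
Proof.
move=> PC PU PD PM p; rewrite [p]monalgE.
apply: (big_ind P) => [||k _]; [by rewrite -malgC0E; apply: PC|exact: PD|].
rewrite malgU_C; apply: (PM) => //; rewrite malgX_prod.
apply: (big_ind P) => [||v _]; [exact: (PC 1)|exact: PM|].
elim: (k v) => [|e IHe]; first exact: (PC 1).
by rewrite exprS; apply: PM.
Qed.

End MalgInd.

(* The endomorphism p(v) |-> p^s(f v): s acts on the coefficients and the
   indeterminate v goes to the indeterminate f v. *)
Section Subst.
Variables (I : choiceType) (R : comNzRingType).
Local Notation A := {malg R[{cmonom I}]}.
Variables (s : {rmorphism R -> R}) (f : I -> I).

Definition cmsubst (k : {cmonom I}) : A :=
  \prod_(v <- finsupp k) << ucm (f v) >> ^+ k v.

Definition malg_subst : A -> A := mmap (@malgC {cmonom I} R \o s) cmsubst.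

Lemma cmsubstEw (d : {fset I}) (k : {cmonom I}) : (finsupp k `<=` d)%fset ->
  cmsubst k = \prod_(v <- d) << ucm (f v) >> ^+ k v.
Proof.
move=> le_kd; rewrite /cmsubst (big_fset_incl _ le_kd) //.
by move=> v _; rewrite -cmE_eq0 => /eqP ->.
Qed.

Lemma cmsubst_mmorphism : mmorphism cmsubst.
Proof.
split=> [k l|]; last by rewrite /cmsubst mdom1 big_seq_fset0.
rewrite {1}/cmsubst mdomD (cmsubstEw (fsubsetUl _ (finsupp l))).
rewrite (cmsubstEw (fsubsetUr (finsupp k) _)) -big_split /=.
by apply: eq_bigr => v _; rewrite cmM exprD.
Qed.

HB.instance Definition _ :=
  isMultiplicative.Build {cmonom I} A cmsubst cmsubst_mmorphism.

HB.instance Definition _ := GRing.RMorphism.copy malg_subst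
  (mmap (@malgC {cmonom I} R \o s) cmsubst).

Lemma malg_substC c : malg_subst c%:MP = (s c)%:MP.
Proof. by rewrite /malg_subst mmapC. Qed.

Lemma malg_substU v : malg_subst << ucm v >> = << ucm (f v) >>.
Proof.
by rewrite /malg_subst mmapU /= rmorph1 mul1r /cmsubst mdomU big_seq_fset1 cmUU.
Qed.

Lemma cmsubstE k : injective f -> exists2 q : {cmonom I},
  cmsubst k = << q >> & forall v, q (f v) = k v.
Proof. exact: malgU_prod. Qed.

Lemma malg_subst_inj : injective s -> injective f -> injective malg_subst.
Proof.
move=> s_inj f_inj; apply: raddf_inj => p p0; apply/malgP => k.
have [q qE q_i] := cmsubstE k f_inj.
have : (malg_subst p)@_q = 0 by rewrite p0 mcoeff0.
rewrite /malg_subst mmapE raddf_sum mcoeff0 /=.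
have trm l : ((s p@_l)%:MP * cmsubst l)@_q = s p@_l *+ (l == k).
  have [r rE r_i] := cmsubstE l f_inj.
  rewrite rE mcoeffCM mcoeffU1; case: (eqVneq l k) => [lk|].
    suff -> : r = q by rewrite eqxx mulr1.
    apply: malgU_inj; exact: etrans (esym rE) (etrans (congr1 cmsubst lk) qE).
  move=> neq_lk; suff /negbTE-> : r != q by rewrite mulr0.
  apply: contra_neq neq_lk => rq; apply/eqP/cmP => v.
  by rewrite -r_i -q_i rq.
rewrite (eq_bigr (fun l => s p@_l *+ (l == k))) => [|l _]; last exact: trm.
have [kp|/mcoeff_outdom //] := boolP (k \in msupp p).
rewrite (big_fsetD1 k) //= eqxx mulr1n big1_fset ?addr0 => [spk|l]; last first.
  rewrite in_fsetD1 => /andP[/negbTE -> _] _; exact: mulr0n.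
apply: s_inj; exact: etrans spk (esym (rmorph0 s)).
Qed.

End Subst.

(* The derivation of R[v : v in I] that extends the derivation d of R and maps
   the indeterminate v to the indeterminate f v: on a monomial k it is
   \sum_v (f v) dk/dv. *)
Section Deriv.
Variables (I : choiceType) (R : comNzRingType).
Local Notation A := {malg R[{cmonom I}]}.
Variables (d : {additive R -> R}) (f : I -> I).

Definition cmderiv (k : {cmonom I}) : A :=
  \sum_(v <- finsupp k) << (k v)%:R *g (ucm (f v) * divcm k (ucm v))%M >>.

Definition malg_deriv : A -> A :=
  mmap (@malgC {cmonom I} R \o d) (fun k => << k >>)
    \+ mmap (@malgC {cmonom I} R) cmderiv.

HB.instance Definition _ := GRing.Additive.copy malg_deriv
  (mmap (@malgC {cmonom I} R \o d) (fun k => << k >>)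
    \+ mmap (@malgC {cmonom I} R) cmderiv).

Lemma cmderivEw (e : {fset I}) (k : {cmonom I}) : (finsupp k `<=` e)%fset ->
  cmderiv k =
    \sum_(v <- e) << (k v)%:R *g (ucm (f v) * divcm k (ucm v))%M >>.
Proof.
move=> le_ke; rewrite /cmderiv (big_fset_incl _ le_ke) //.
by move=> v _; rewrite -cmE_eq0 => /eqP ->; rewrite monalgU0.
Qed.

Lemma cmderivM k l :
  cmderiv (k * l)%M = cmderiv k * << l >> + << k >> * cmderiv l.
Proof.
have divM (a b : {cmonom I}) v :
    << (a v)%:R *g (ucm (f v) * divcm (a * b) (ucm v))%M >>
    = << (a v)%:R *g (ucm (f v) * divcm a (ucm v))%M >> * << b >> :> A.
  rewrite malgUM mulr1 -mulmA; case: (posnP (a v)) => [->|av].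
    by rewrite !monalgU0.
  have -> : divcm (a * b)%M (ucm v) = (divcm a (ucm v) * b)%M; last by [].
  apply/eqP/cmP => i; rewrite divcmE !cmM divcmE ucmE; case: eqVneq => [<-|_].
    by rewrite addnBAC.
  by rewrite !subn0.
rewrite {1}/cmderiv mdomD (cmderivEw (fsubsetUl _ (finsupp l))).
rewrite (cmderivEw (fsubsetUr (finsupp k) _)) mulr_sumr [in RHS]mulr_suml.
rewrite -big_split /=.
apply: eq_bigr => v _; rewrite cmM natrD monalgUD divM; congr (_ + _).
rewrite (mulmC k l) divM; exact: mulrC.
Qed.

Lemma malg_derivE c k :
  malg_deriv << c *g k >> = (d c)%:MP * << k >> + c%:MP * cmderiv k.
Proof.
apply: (congr2 +%R); last exact: mmapU.
exact: (mmapU (f := @malgC {cmonom I} R \o d)).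
Qed.

Lemma malg_derivM :
  (forall x y, d (x * y) = d x * y + x * d y) ->
  forall p q, malg_deriv (p * q) = malg_deriv p * q + p * malg_deriv q.
Proof.
move=> dM p q; elim/malgU_ind: p => [|p p' IHp IHp'|a k].
- exact: leibniz0l.
- exact (@leibnizDl A malg_deriv _ _ _ IHp IHp').
elim/malgU_ind: q => [|q q' IHq IHq'|b l].
- exact: leibniz0r.
- exact (@leibnizDr A malg_deriv _ _ _ IHq IHq').
have CM x y : (x * y)%:MP = x%:MP * y%:MP :> A by exact: rmorphM.
have CD x y : (x + y)%:MP = x%:MP + y%:MP :> A by exact: raddfD.
have E : malg_deriv (<< a *g k >> * << b *g l >>) =
    ((d a)%:MP * b%:MP + a%:MP * (d b)%:MP) * (<< k >> * << l >>)
      + a%:MP * b%:MP * (cmderiv k * << l >> + << k >> * cmderiv l).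
  refine (etrans (congr1 malg_deriv (malgUM a b k l)) _).
  refine (etrans (malg_derivE _ _) _).
  rewrite dM CD !CM malgX_M cmderivM; reflexivity.
refine (etrans E _); refine (etrans (leibniz_prod _ _ _ _ _ _ _ _) _).
exact (esym (congr2 +%R
  (congr2 *%R (malg_derivE a k) (malgU_C b l))
  (congr2 *%R (malgU_C a k) (malg_derivE b l)))).
Qed.

Lemma malg_derivC c : malg_deriv c%:MP = (d c)%:MP.
Proof.
have d1 : cmderiv mone = 0 by rewrite /cmderiv mdom1 big_seq_fset0.
refine (etrans (malg_derivE _ _) _).
exact (etrans (congr2 +%R (mulr1 (d c)%:MP)
  (etrans (congr1 ( *%R c%:MP) d1) (mulr0 _))) (addr0 _)).
Qed.

Lemma malg_derivU v :
  (forall x y, d (x * y) = d x * y + x * d y) ->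
  malg_deriv << ucm v >> = << ucm (f v) >>.
Proof.
move=> dM.
have dv : cmderiv (ucm v) = << ucm (f v) >>.
  rewrite /cmderiv mdomU big_seq_fset1 cmUU.
  have -> : (ucm (f v) * divcm (ucm v) (ucm v))%M = ucm (f v); last reflexivity.
  by apply/eqP/cmP => i; rewrite cmM divcmE subnn addn0.
have d1 : (d 1)%:MP = 0 :> A by rewrite (leibniz1 dM) malgC0E.
refine (etrans (malg_derivE _ _) _).
exact (etrans (congr2 +%R (etrans (congr1 ( *%R^~ << ucm v >>) d1) (mul0r _))
  (etrans (congr1 ( *%R 1) dv) (mul1r _))) (add0r _)).
Qed.

End Deriv.

(* (k, l) stands for delta_1^(k_1) ... delta_m^(k_m) sigma^l. *)
Definition dsop (m : nat) : Type := ({ffun 'I_m -> nat} * nat)%type.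
HB.instance Definition _ m := Choice.on (dsop m).

Definition dsop_delta m (i : 'I_m) (t : dsop m) : dsop m :=
  ([ffun j => (t.1 j + (j == i))%N], t.2).
Definition dsop_sigma m (t : dsop m) : dsop m := (t.1, t.2.+1).

(* The indeterminate (t, j) stands for t y_j. *)
Definition dspoly (m n : nat) (K : dsRingType m) : Type :=
  {malg K[{cmonom (dsop m * 'I_n)%type}]}.
HB.instance Definition _ m n (K : dsRingType m) :=
  GRing.ComNzRing.on (@dspoly m n K).

Notation "{ 'dspoly' K [ n ] }" := (@dspoly _ n K)
  (at level 0, K at level 2, n at level 2, format "{ 'dspoly'  K [ n ] }")
  : type_scope.

Section DSPoly.
Variables (m n : nat) (K : dsRingType m).
Local Notation V := (dsop m * 'I_n)%type.

Definition dspolyC (c : K) : {dspoly K[n]} := c%:MP.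

Definition dspolyX (t : dsop m) (j : 'I_n) : {dspoly K[n]} :=
  << ucm ((t, j) : V) >>.

Definition dspoly_delta (i : 'I_m) : {dspoly K[n]} -> {dspoly K[n]} :=
  malg_deriv (ds_delta i) (fun v : V => (dsop_delta i v.1, v.2)).

Definition dspoly_sigma : {dspoly K[n]} -> {dspoly K[n]} :=
  malg_subst ds_sigma (fun v : V => (dsop_sigma v.1, v.2)).

HB.instance Definition _ i := GRing.Additive.copy (dspoly_delta i)
  (malg_deriv (ds_delta i) (fun v : V => (dsop_delta i v.1, v.2))).
HB.instance Definition _ := GRing.RMorphism.copy dspoly_sigma
  (malg_subst (@ds_sigma m K) (fun v : V => (dsop_sigma v.1, v.2))).

Lemma dspoly_deltaEC i c : dspoly_delta i (dspolyC c) = dspolyC (ds_delta i c).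
Proof. exact: malg_derivC. Qed.

Lemma dspoly_deltaEX i t j :
  dspoly_delta i (dspolyX t j) = dspolyX (dsop_delta i t) j.
Proof. by rewrite /dspoly_delta /dspolyX malg_derivU //; apply: ds_deltaM. Qed.

Lemma dspoly_sigmaEC c : dspoly_sigma (dspolyC c) = dspolyC (ds_sigma c).
Proof. exact: malg_substC. Qed.

Lemma dspoly_sigmaEX t j :
  dspoly_sigma (dspolyX t j) = dspolyX (dsop_sigma t) j.
Proof. exact: malg_substU. Qed.

Lemma dspoly_ind (P : {dspoly K[n]} -> Prop) :
  (forall c, P (dspolyC c)) -> (forall t j, P (dspolyX t j)) ->
  (forall p q, P p -> P q -> P (p + q)) ->
  (forall p q, P p -> P q -> P (p * q)) -> forall p, P p.
Proof.
move=> PC PX PD PM.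
exact (malg_ind PC (fun v => let: (t, j) := v in PX t j) PD PM).
Qed.

Lemma dspoly_deltaM i (p q : {dspoly K[n]}) :
  dspoly_delta i (p * q) = dspoly_delta i p * q + p * dspoly_delta i q.
Proof. by apply: malg_derivM; apply: ds_deltaM. Qed.

Lemma dspoly_sigma_inj : injective dspoly_sigma.
Proof.
apply: malg_subst_inj; first exact: ds_sigma_inj.
by move=> [[t l] j] [[t' l'] j'] [-> -> ->].
Qed.

Lemma dspoly_deltaC i i' (p : {dspoly K[n]}) :
  dspoly_delta i (dspoly_delta i' p) = dspoly_delta i' (dspoly_delta i p).
Proof.
elim/dspoly_ind: p => [c|t j|p q IHp IHq|p q IHp IHq].
- have E k k' : dspoly_delta k (dspoly_delta k' (dspolyC c)) =
      dspolyC (ds_delta k (ds_delta k' c)).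
    exact (etrans (congr1 _ (dspoly_deltaEC k' c)) (dspoly_deltaEC k _)).
  exact (etrans (E i i') (etrans (congr1 _ (ds_deltaC i i' c)) (esym (E i' i)))).
- have E k k' : dspoly_delta k (dspoly_delta k' (dspolyX t j)) =
      dspolyX (dsop_delta k (dsop_delta k' t)) j.
    exact (etrans (congr1 _ (dspoly_deltaEX k' t j)) (dspoly_deltaEX k _ j)).
  have T : dsop_delta i (dsop_delta i' t) = dsop_delta i' (dsop_delta i t).
    by congr (_, _); apply/ffunP => k; rewrite !ffunE addnAC.
  exact (etrans (E i i') (etrans (congr1 (dspolyX^~ j) T) (esym (E i' i)))).
- exact (@comm_addD _ (dspoly_delta i) (dspoly_delta i') _ _ IHp IHq).
- exact (@leibniz_commM _ (dspoly_delta i) (dspoly_deltaM i)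
    (dspoly_delta i') _ _ (dspoly_deltaM i') IHp IHq).
Qed.

Lemma dspoly_delta_sigmaC i (p : {dspoly K[n]}) :
  dspoly_delta i (dspoly_sigma p) = dspoly_sigma (dspoly_delta i p).
Proof.
elim/dspoly_ind: p => [c|t j|p q IHp IHq|p q IHp IHq].
- refine (etrans (congr1 _ (dspoly_sigmaEC c)) _).
  refine (etrans (dspoly_deltaEC _ _) _); rewrite ds_delta_sigmaC.
  refine (esym (etrans (congr1 _ (dspoly_deltaEC i c)) _)).
  exact (dspoly_sigmaEC _).
- refine (etrans (congr1 _ (dspoly_sigmaEX t j)) _).
  refine (etrans (dspoly_deltaEX _ _ _) _).
  refine (esym (etrans (congr1 _ (dspoly_deltaEX i t j)) _)).
  exact (dspoly_sigmaEX _ j).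
- exact (@comm_addD _ (dspoly_delta i) dspoly_sigma _ _ IHp IHq).
- exact (@leibniz_rmorphM _ (dspoly_delta i) (dspoly_deltaM i)
    dspoly_sigma _ _ IHp IHq).
Qed.

HB.instance Definition _ := ComNzRing_isDSRing.Build m {dspoly K[n]}
  dspoly_deltaM dspoly_sigma_inj dspoly_deltaC dspoly_delta_sigmaC.

End DSPoly.

(* Main.v *)
(* A prime P, inside a larger prime Q, is controlled by the pairs (v, d) such
   that P contains a polynomial of degree d in its leader v whose initial and
   separant avoid Q: once these pairs exhaust the ranks of Q, cross-multiplying
   initials gives P = Q.  The set of these pairs is stable under the
   derivations (the separant becomes the initial), and under sigma when Q is
   reflexive, so Dickson's lemma settles chains whose union is reflexive.
   In general let U be the union of the chain P_i and Q its reflexive closure.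
   The reflexive case, applied first to the sigma^-k U and then to the
   sigma^-k P_i, gives a k with Q = sigma^-k U = sigma^-k P_i for large i.
   Discarding the indeterminates of sigma-order less than s shrinks the pairs of
   Q, but up to a shift they grow with s, hence stabilise, so all high pairs come
   from sigma^k Q, which lies in P_i.  Thus P_i and Q agree on the
   indeterminates of sigma-order at least some s0.  Over the subring generated
   by these, only finitely many families of derivatives remain and the argument
   is repeated with the derivations alone. *)
From HB Require Import structures.
Require Import Defs.
From mathcomp Require Import all_boot all_order all_algebra.
From mathcomp Require Import boolp classical_sets.
From mathcomp.multinomials Require Import monalg.

Set Implicit Arguments.
Unset Strict Implicit.
Unset Printing Implicit Defensive.

Import Order.TTheory GRing.Theory.

Local Open Scope ring_scope.
Local Open Scope classical_set_scope.

(** * Dickson's lemma for ascending chains of exponent sets *)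

Lemma stable_le (T : Type) (S : nat -> set T) i j :
  (forall k, S k `<=` S k.+1) -> (i <= j)%N -> S i `<=` S j.
Proof.
move=> S_le /subnK <-; elim: (j - i)%N => // k IHk s /IHk; exact: S_le.
Qed.

(* The diagonal of slices [S i (i :: _)] is an ascending chain in dimension
   one less; beyond its stabilisation index every slice is already constant. *)
Lemma dickson_chain N (S : nat -> set (seq nat)) :
  (forall i, S i `<=` S i.+1) ->
  (forall i s k, size s = N -> (k < N)%N -> S i s -> S i (incr_nth s k)) ->
  exists j, forall i s, size s = N -> S i s -> S j s.
Proof.
elim: N S => [|N IHN] S S_le S_incr.
  have [[j Sj]|S0] := pselect (exists j, S j [::]).
    by exists j => i s /size0nil ->.
  by exists 0 => i s /size0nil -> Si; case: S0; exists i.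
have S_head i b a s : size s = N -> (a <= b)%N -> S i (a :: s) -> S i (b :: s).
  move=> sN /subnK <-; elim: (b - a)%N => // c IHc /IHc Sc.
  by apply: (S_incr i (_ :: s) 0%N) => //=; rewrite sN.
(* The size condition is part of the diagonal because raising the head by [S_head] requires it. *)
have [|i s k sN kN|j0 j0P] := IHN (fun i s => S i (i :: s) /\ size s = N).
- move=> i s [/S_le Si sN]; split=> //; exact: S_head Si.
- move=> [Si _]; rewrite size_incr_nth sN kN; split=> //.
  by apply: (S_incr i (_ :: s) k.+1) => //=; rewrite sN.
have slice a : exists j, forall i s, size s = N -> S i (a :: s) -> S j (a :: s).
  apply: (IHN (fun i s => S i (a :: s))) => [i s|i s k sN kN]; first exact: S_le.
  by apply: (S_incr i (_ :: s) k.+1) => //=; rewrite sN.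
have [g gP] := choice slice.
exists (maxn j0 (\max_(a < j0) g a)) => i [//|a s] /= [sN] Si.
have [lt_aj|le_ja] := ltnP a j0.
  apply: stable_le (gP _ _ _ sN Si) => //; rewrite leq_max.
  by rewrite (leq_bigmax (Ordinal lt_aj)) orbT.
(* From index [i] and head [a] climb to the diagonal at [maxn i a], descend to [j0] by
   stabilisation, then raise the head back to [a]. *)
have [|Sj _] := j0P (maxn i a) s sN.
  split=> //; apply: (S_head _ _ a) => //; first exact: leq_maxr.
  by apply: stable_le Si => //; exact: leq_maxl.
apply: (@stable_le _ S j0) => //; first exact: leq_maxl.
exact: S_head Sj.
Qed.

Lemma dickson_chain_fin (J : finType) N (S : nat -> J -> set (seq nat)) :
  (forall i j, S i j `<=` S i.+1 j) ->
  (forall i j s k, size s = N -> (k < N)%N -> S i j s ->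
    S i j (incr_nth s k)) ->
  exists i0, forall i j s, size s = N -> S i j s -> S i0 j s.
Proof.
move=> S_le S_incr.
have /choice[g gP] j : exists i0, forall i s, size s = N -> S i j s -> S i0 j s.
  by apply: (@dickson_chain N (S^~ j)) => i; [exact: S_le | exact: S_incr].
exists (\max_j g j) => i j s sN /(gP _ _ _ sN); apply: (stable_le (S := S^~ j)).
  by move=> k; exact: S_le.
exact: leq_bigmax.
Qed.

(** * Lexicographic induction and the ranking of the indeterminates *)

Lemma ltxi_ind N (T : set (seqlexi nat)) :
  (forall s : seqlexi nat, size s = N ->
    (forall t : seqlexi nat, size t = N -> (t < s)%O -> T t) -> T s) ->
  forall s : seqlexi nat, size s = N -> T s.
Proof.
elim: N T => [|N IHN] T T_ind.
  by move=> s sN; apply: T_ind => // t _; rewrite (size0nil sN) ltxis0.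
suff H a : forall s, size s = N -> T (a :: s) by case=> // a s [/H].
(* At fixed length the lexicographic order is well founded: induct on the head, then on the tail
   under that head. *)
elim/ltn_ind: a => a IHa; apply: (IHN (fun s => T (a :: s))) => s sN IHs.
apply: T_ind => [|[//|b t] [tN]]; first by rewrite /= sN.
have [/IHa Hb _|lt_ab|->] := ltngtP b a; first exact: Hb.
  by rewrite ltxi_cons !leEnat leqNgt lt_ab.
by rewrite eqhead_ltxiE; exact: IHs.
Qed.

Lemma ltxi_incr_nth k (s t : seqlexi nat) : (k < size s)%N -> (k < size t)%N ->
  (s < t)%O -> ((incr_nth s k : seqlexi nat) < incr_nth t k)%O.
Proof.
elim: k s t => [|k IHk] [|a s] [|b t] //=; rewrite !ltxi_cons !leEnat //.
move=> ks kt /andP[-> /implyP st]; apply/implyP => /st; exact: IHk.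
Qed.

Lemma lt_incr_nth k (s : seqlexi nat) : (s < incr_nth s k :> seqlexi nat)%O.
Proof.
elim: k s => [|k IHk] [|a s]; rewrite /= ?ltxi_cons ?leEnat ?leqnSn ?ltnn //.
by rewrite leqnn /=; exact: IHk.
Qed.

Section Ranking.
Variables m n : nat.
Local Notation V := (dsop m * 'I_n)%type.

Definition var_delta (i : 'I_m) (v : V) : V := (dsop_delta i v.1, v.2).
Definition var_sigma (v : V) : V := (dsop_sigma v.1, v.2).

Definition dsop_of (l : nat) (s : seq nat) : dsop m :=
  ([ffun i : 'I_m => nth 0%N s i], l).
Definition dsop_exp (t : dsop m) : seq nat := [seq t.1 i | i <- enum 'I_m].

Lemma size_dsop_exp t : size (dsop_exp t) = m.
Proof. by rewrite size_map size_enum_ord. Qed.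

Lemma nth_dsop_exp t (i : 'I_m) : nth 0%N (dsop_exp t) i = t.1 i.
Proof. by rewrite (nth_map i) ?size_enum_ord // nth_ord_enum. Qed.

Lemma dsop_expK t : dsop_of t.2 (dsop_exp t) = t.
Proof.
case: t => t l; congr (_, _); apply/ffunP => i.
by rewrite ffunE nth_dsop_exp.
Qed.

Lemma dsop_of_incr l s (i : 'I_m) :
  dsop_of l (incr_nth s i) = dsop_delta i (dsop_of l s).
Proof.
congr (_, _); apply/ffunP => j; rewrite !ffunE nth_incr_nth addnC.
by rewrite -val_eqE /= eq_sym.
Qed.

Lemma dsop_exp_delta t (i : 'I_m) :
  dsop_exp (dsop_delta i t) = incr_nth (dsop_exp t) i.
Proof.
apply: (@eq_from_nth _ 0%N) => [|j].
  by rewrite size_incr_nth !size_dsop_exp ltn_ord.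
rewrite size_dsop_exp => jm; rewrite nth_incr_nth.
rewrite -[j]/(nat_of_ord (Ordinal jm)) !nth_dsop_exp ffunE addnC.
by rewrite -val_eqE /= eq_sym.
Qed.

(** Index of the indeterminate, then sigma-order, then derivation exponents: each operator
    increments one entry of a key of fixed length [m + 2], hence respects the order. *)
Definition var_key (v : V) : seqlexi nat := (v.2 : nat) :: v.1.2 :: dsop_exp v.1.
Definition var_lt (v w : V) : Prop := (var_key v < var_key w)%O.

Lemma var_key_inj : injective var_key.
Proof.
move=> [t j] [t' j'] [/val_inj /= -> tl te].
by rewrite -(dsop_expK t) -(dsop_expK t') tl te.
Qed.

Lemma var_key_delta i v : var_key (var_delta i v) = incr_nth (var_key v) i.+2.
Proof. by rewrite /var_key dsop_exp_delta. Qed.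

Lemma var_key_sigma v : var_key (var_sigma v) = incr_nth (var_key v) 1.
Proof. by []. Qed.

Lemma var_lt_wf : well_founded var_lt.
Proof.
suff H : forall s, size s = m.+2 -> forall v, var_key v = s -> Acc var_lt v.
  by move=> v; apply: (H (var_key v)) => //; rewrite /= size_dsop_exp.
apply: ltxi_ind => s sN IH v vs; constructor => w w_lt.
by apply: (IH (var_key w)) => //; [rewrite /= size_dsop_exp | rewrite -vs].
Qed.

Lemma var_lt_trans v u w : var_lt u v -> var_lt v w -> var_lt u w.
Proof. exact: lt_trans. Qed.

Lemma var_lt_total v w : [\/ v = w, var_lt v w | var_lt w v].
Proof.
rewrite /var_lt; case: (ltgtP (var_key v) (var_key w)) => [||/var_key_inj].
- by constructor 2.
- by constructor 3.
- by constructor 1.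
Qed.

Lemma var_lt_delta i v : var_lt v (var_delta i v).
Proof. by rewrite /var_lt var_key_delta lt_incr_nth. Qed.

Lemma var_delta_lt i v w : var_lt v w -> var_lt (var_delta i v) (var_delta i w).
Proof.
by rewrite /var_lt !var_key_delta; apply: ltxi_incr_nth;
  rewrite /= size_dsop_exp !ltnS.
Qed.

Lemma var_sigma_lt v w : var_lt v w -> var_lt (var_sigma v) (var_sigma w).
Proof. by rewrite /var_lt !var_key_sigma; apply: ltxi_incr_nth. Qed.

Lemma iter_var_sigma k v : iter k var_sigma v = ((v.1.1, k + v.1.2)%N, v.2).
Proof. by elim: k => [|k IHk] /=; [case: v => [[]] | rewrite IHk]. Qed.

Section Chain.
Variable S : nat -> V -> set nat.
Hypotheses (S_le : forall i v, S i v `<=` S i.+1 v)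
  (S_succ : forall i v d, S i v d -> S i v d.+1)
  (S_delta : forall i v a d, S i v d -> S i (var_delta a v) d).

(** The bounded sigma-order joins the finite index, so the Dickson coordinates are the degree and
    the [m] derivation exponents. *)
Lemma var_chain_level l0 : exists i0, forall i v d,
  (v.1.2 < l0)%N -> S i v d -> S i0 v d.
Proof.
have [||i0 i0P] := @dickson_chain_fin ('I_l0 * 'I_n)%type m.+1
  (fun i lj s => S i (dsop_of lj.1 (behead s), lj.2) (head 0%N s)).
- by move=> i lj s; exact: S_le.
- move=> i lj [//|d s] [|k] /= _ km; first exact: S_succ.
  rewrite -[k]/(nat_of_ord (Ordinal (km : k < m)%N)) dsop_of_incr.
  exact: S_delta.
exists i0 => i [t j] d /= lt_t; rewrite -{1 2}[t]dsop_expK => Si.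
apply: (i0P i (Ordinal lt_t, j) (d :: dsop_exp t)) => //.
by rewrite /= size_dsop_exp.
Qed.

Hypothesis S_sigma : forall i v d, S i v d -> S i (var_sigma v) d.

Lemma var_chain : exists i0, forall i v d, S i v d -> S i0 v d.
Proof.
have [||i0 i0P] := @dickson_chain_fin 'I_n m.+2
  (fun i j s =>
     S i (dsop_of (nth 0%N s 1) (behead (behead s)), j) (head 0%N s)).
- by move=> i j s; exact: S_le.
- move=> i j [//|d [//|l s]] [|[|k]] /= _ km; first exact: S_succ.
    exact: S_sigma.
  rewrite -[k]/(nat_of_ord (Ordinal (km : k < m)%N)) dsop_of_incr.
  exact: S_delta.
exists i0 => i [t j] d; rewrite -{1 2}[t]dsop_expK => Si.
apply: (i0P i j (d :: t.2 :: dsop_exp t)) => //.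
by rewrite /= size_dsop_exp.
Qed.

End Chain.
End Ranking.

(** * Generated subrings and the comparison of two primes *)

Section SubringGen.
Variables (R : comNzRingType) (V : Type) (x : V -> R).

(** The [x v] may be algebraically dependent, so leaders and degrees belong to chosen
    representations. [C] is an arbitrary set, so that it can later absorb the indeterminates of high
    sigma-order. *)
Inductive subring_gen (C : set R) (W : set V) : set R :=
| sgen_base c : C c -> subring_gen C W c
| sgen_var v : W v -> subring_gen C W (x v)
| sgen1 : subring_gen C W 1
| sgenB f g : subring_gen C W f -> subring_gen C W g -> subring_gen C W (f - g)
| sgenM f g : subring_gen C W f -> subring_gen C W g -> subring_gen C W (f * g).

Lemma sgen0 C W : subring_gen C W 0.
Proof. by rewrite -(subrr 1); apply: sgenB; exact: sgen1. Qed.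

Lemma sgenD C W f g :
  subring_gen C W f -> subring_gen C W g -> subring_gen C W (f + g).
Proof.
by move=> Wf Wg; rewrite -[g]opprK -[- g]sub0r; do 2![apply: sgenB => //];
  exact: sgen0.
Qed.

Lemma sgen_mulrn C W f k : subring_gen C W f -> subring_gen C W (f *+ k).
Proof.
move=> Wf; elim: k => [|k IHk]; first exact: sgen0.
by rewrite mulrS; apply: sgenD.
Qed.

Lemma sgen_sub C C' W W' f : C `<=` subring_gen C' W' ->
  (forall v, W v -> subring_gen C' W' (x v)) ->
  subring_gen C W f -> subring_gen C' W' f.
Proof.
by move=> CC' WW'; elim=> [c /CC'|v /WW'||g h _ IHg _ IHh|g h _ IHg _ IHh];
  [| |exact: sgen1|exact: sgenB|exact: sgenM].
Qed.

Lemma sgenS C W W' f : W `<=` W' -> subring_gen C W f -> subring_gen C W' f.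
Proof.
move=> WW'; apply: sgen_sub => [c|v /WW']; [exact: sgen_base|exact: sgen_var].
Qed.

Lemma sgen_horner C W (p : {poly R}) u :
  (forall i, subring_gen C W p`_i) -> subring_gen C W u ->
  subring_gen C W p.[u].
Proof.
move=> Wp Wu; rewrite horner_coef; apply: (big_ind (subring_gen C W)).
- exact: sgen0.
- exact: sgenD.
move=> i _; apply: sgenM => //; elim: (i : nat) => [|k IHk].
  exact: sgen1.
by rewrite exprS; apply: sgenM.
Qed.

Lemma sgen_poly C W v f : subring_gen C W f ->
  exists p : {poly R}, f = p.[x v] /\
    forall i, subring_gen C [set w | W w /\ w <> v] p`_i.
Proof.
have C0 c : subring_gen C [set w | W w /\ w <> v] c ->
    exists p : {poly R}, c = p.[x v] /\
      forall i, subring_gen C [set w | W w /\ w <> v] p`_i.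
  move=> Cc; exists c%:P; rewrite hornerC; split=> // i; rewrite coefC.
  by case: eqP => // _; exact: sgen0.
elim=> [c Cc|w Ww||g h _ [p [-> Wp]] _ [q [-> Wq]]|g h _ [p [-> Wp]] _ [q [-> Wq]]].
- by apply: C0; exact: sgen_base.
- have [<-|wv] := pselect (w = v); last by apply: C0; exact: sgen_var.
  exists 'X; rewrite hornerX; split=> // i; rewrite coefX.
  by case: eqP => _; [exact: sgen1 | exact: sgen0].
- by apply: C0; exact: sgen1.
- exists (p - q); rewrite !hornerE; split=> // i.
  by rewrite coefB; apply: sgenB.
exists (p * q); rewrite !hornerE; split=> // i; rewrite coefM.
by apply: (big_ind (subring_gen C _)); [exact: sgen0|exact: sgenD|
  by move=> j _; apply: sgenM].
Qed.

Variable lt : V -> V -> Prop.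
Hypotheses (lt_wf : well_founded lt)
  (lt_trans : forall v u w, lt u v -> lt v w -> lt u w)
  (lt_total : forall v w, [\/ v = w, lt v w | lt w v]).
Local Notation below W v := [set w | W w /\ lt w v].

(** An expression involves finitely many indeterminates; under an operation the larger of two
    leaders bounds both arguments. *)
Lemma sgen_max C W f : subring_gen C W f ->
  subring_gen C set0 f \/
  exists2 v, W v & subring_gen C [set w | W w /\ (w = v \/ lt w v)] f.
Proof.
pose T f := subring_gen C set0 f \/
  exists2 v, W v & subring_gen C [set w | W w /\ (w = v \/ lt w v)] f.
have T2 (op : R -> R -> R) g h :
    (forall W' g h, subring_gen C W' g -> subring_gen C W' h ->
      subring_gen C W' (op g h)) ->
    T g -> T h -> T (op g h).
  move=> opP [Cg|[v Wv vg]] [Ch|[w Ww wh]]; first by left; exact: opP.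
  - by right; exists w => //; apply: opP wh; apply: sgenS Cg => ? [].
  - by right; exists v => //; apply: opP vg _; apply: sgenS Ch => ? [].
  have le_trans u v' w' : lt v' w' -> u = v' \/ lt u v' -> u = w' \/ lt u w'.
    by move=> vw' [->|/lt_trans/(_ vw')]; right.
  right; have [vw|vw|wv] := lt_total v w.
  - by exists v => //; apply: opP => //; rewrite vw.
  - exists w => //; apply: opP wh; apply: sgenS vg => u [Wu uv].
    by split=> //; exact: le_trans uv.
  exists v => //; apply: opP vg _; apply: sgenS wh => u [Wu uw].
  by split=> //; exact: le_trans uw.
elim=> [c Cc|v Wv||g h _ IHg _ IHh|g h _ IHg _ IHh].
- by left; exact: sgen_base.
- by right; exists v => //; apply: sgen_var; split=> //; left.
- by left; exact: sgen1.
- by apply: (T2 (fun f g => f - g)) => //; exact: sgenB.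
- by apply: (T2 (fun f g => f * g)) => //; exact: sgenM.
Qed.

(* [p.[x v]] is a polynomial of degree at most [d] in its leader [v]. *)
Definition ranked (C : set R) (W : set V) (v : V) (d : nat) (p : {poly R}) :=
  [/\ W v, (size p <= d.+1)%N & forall i, subring_gen C (below W v) p`_i].

(* Cross-multiplying the leading coefficients of [f] in [Q] and of an element
   of [P] of the same rank lowers the degree of [f] in its leader. *)
Lemma ranked_prime_sub C W (P Q : set R) :
  is_prime_ideal P -> is_prime_ideal Q -> P `<=` Q ->
  subring_gen C set0 `&` Q `<=` P ->
  (forall v d p, ranked C W v d p -> Q p.[x v] -> ~ Q p`_d ->
     exists q, [/\ ranked C W v d q, P q.[x v] & ~ Q q`_d]) ->
  subring_gen C W `&` Q `<=` P.
Proof.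
move=> [Pi _ PM] [Qi _ QM] PQ CQP PQ_ranked.
have opp (T : set R) f : is_ideal T -> T f -> T (- f).
  by move=> [_ _ TM] Tf; rewrite -mulN1r; exact: TM.
(* Passing to a largest indeterminate reduces a claim over [D] to one for each leader in [D]; used
   for all indeterminates and for those below [v]. *)
have below_sub D : (forall v, D v -> W v ->
      subring_gen C [set w | W w /\ (w = v \/ lt w v)] `&` Q `<=` P) ->
    subring_gen C [set w | W w /\ D w] `&` Q `<=` P.
  move=> DP f [Df Qf]; have [Cf|[v [Wv Dv] vf]] := sgen_max Df.
    exact: CQP.
  by apply: (DP v Dv Wv); split=> //; apply: sgenS vf => w [[Ww _]].
suff H v : W v ->
    subring_gen C [set w | W w /\ (w = v \/ lt w v)] `&` Q `<=` P.
  move=> f [Wf Qf]; apply: (below_sub setT) => [v _|]; first exact: H.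
  by split=> //; apply: sgenS Wf.
elim/(well_founded_induction lt_wf): v => v IHv Wv f [vf Qf].
have [p [fE Wp]] := sgen_poly v vf; rewrite fE in Qf *.
have {}Wp i : subring_gen C (below W v) p`_i.
  by apply: sgenS (Wp i) => w /= [[Ww []]].
have IH g : subring_gen C (below W v) g -> Q g -> P g.
  by move=> vg Qg; apply: (below_sub (lt^~ v)).
have [d] := ubnP (size p); elim: d p {f vf fE} Qf Wp => // d IHd p Qp Wp.
rewrite ltnS leq_eqVlt => /orP[/eqP pd|]; last exact: IHd.
case: d pd IHd => [/eqP|d pd IHd].
  by rewrite size_poly_eq0 => /eqP -> _; rewrite horner0; case: Pi.
(* An initial in [Q] is in [P] by the outer induction, so the leading term can be removed. *)
have [Qpd|Qpd] := pselect (Q p`_d).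
  have Ppd : P (p`_d * x v ^+ d) by rewrite mulrC; apply: (idealMl Pi); apply: IH.
  have pE : p = take_poly d p + p`_d *: 'X^d.
    apply/polyP => i; rewrite coefD coef_take_poly coefZ coefXn.
    case: ltngtP => [_|lt_di|->]; rewrite ?mulr0 ?mulr1 ?addr0 ?add0r //.
    by apply/leq_sizeP: i lt_di; rewrite pd.
  have hE : p.[x v] = (take_poly d p).[x v] + p`_d * x v ^+ d.
    by rewrite {1}pE !hornerE.
  rewrite hE; apply: (idealD Pi) => //; apply: IHd.
  - rewrite -[X in Q X](addrK (p`_d * x v ^+ d)) -hE; apply: (idealD Qi) => //.
    by apply: opp => //; exact: PQ.
  - by move=> i; rewrite coef_take_poly; case: ifP => // _; exact: sgen0.
  - by rewrite ltnS size_take_poly.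
have [|q [[_ sq Wq] Pq Qqd]] := PQ_ranked v d p _ Qp Qpd.
  by split=> //; rewrite pd.
(* The initial of [q] avoids [Q], hence [P], and is cancelled by primality; in [r] the terms of
   degree [d] cancel. *)
suff: P (q`_d * p.[x v]) by case/PM => // /PQ.
pose r := q`_d *: p - p`_d *: q.
have -> : q`_d * p.[x v] = r.[x v] + p`_d * q.[x v].
  by rewrite !hornerE subrK.
apply: (idealD Pi); last exact: (idealMl Pi).
apply: IHd.
- rewrite !hornerE; apply: (idealD Qi); first exact: (idealMl Qi).
  by apply: opp => //; apply: (idealMl Qi); exact: PQ.
- by move=> i; rewrite !coefE; apply: sgenB; apply: sgenM.
rewrite ltnS; apply/leq_sizeP => i; rewrite !coefE leq_eqVlt.
case/orP => [/eqP <-|lt_di]; first by rewrite mulrC subrr.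
rewrite (nth_default _ (leq_trans sq lt_di)) [p`_i]nth_default ?pd //.
by rewrite !mulr0 subrr.
Qed.

End SubringGen.

(** * Chain rule, unions of chains and preimages under sigma *)

Lemma delta_horner (R : comNzRingType) (D : {additive R -> R}) :
  (forall a b, D (a * b) = D a * b + a * D b) ->
  forall (p : {poly R}) u,
    D p.[u] = (map_poly D p).[u] + p^`().[u] * D u.
Proof.
move=> DM p u; elim/poly_ind: p => [|p c IHp].
  by rewrite map_poly0 deriv0 !horner0 raddf0 mul0r addr0.
have -> : map_poly D (p * 'X + c%:P) = map_poly D p * 'X + (D c)%:P.
  apply/polyP => i; rewrite coef_map !coefD !coefMX !coefC coef_map raddfD.
  by case: i => [|i]; rewrite ?raddf0.
rewrite derivD derivM derivX derivC !hornerE raddfD DM IHp /=.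
by rewrite mulrDl mulrDl mulrAC -!addrA; congr (_ + _); rewrite addrC addrA
  [RHS]addrC addrA.
Qed.

Lemma is_prime_ideal_bigcup (R : comNzRingType) (P : nat -> set R) :
  (forall i, P i `<=` P i.+1) -> (forall i, is_prime_ideal (P i)) ->
  is_prime_ideal [set f | exists i, P i f].
Proof.
move=> P_le Pp; split.
- split; first by exists 0%N; case: (Pp 0%N) => -[].
  + move=> f g [i Pf] [j Pg]; exists (maxn i j).
    apply: (idealD (prime_ideal_ideal (Pp _))).
      by apply: stable_le Pf => //; exact: leq_maxl.
    by apply: stable_le Pg => //; exact: leq_maxr.
  + by move=> a f [i Pf]; exists i; apply: (idealMl (prime_ideal_ideal (Pp _))).
- by move=> [i]; exact: prime_ideal_proper.
by move=> f g [i] /(prime_idealM (Pp i))[] ?; [left|right]; exists i.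
Qed.

Lemma is_ds_ideal_bigcup m (R : dsRingType m) (P : nat -> set R) :
  (forall i, P i `<=` P i.+1) -> (forall i, is_prime_ds_ideal (P i)) ->
  is_prime_ds_ideal [set f | exists i, P i f].
Proof.
move=> P_le Pp; have Pprime : is_prime_ideal [set f | exists i, P i f].
  by apply: is_prime_ideal_bigcup => // i; case: (Pp i).
split=> //; split; first by case: Pprime.
  by move=> a f [i Pf]; exists i; case: (Pp i) => -[_ Pd _] _; exact: Pd.
by move=> f [i Pf]; exists i; case: (Pp i) => -[_ _ Ps] _; exact: Ps.
Qed.

Lemma is_prime_ds_ideal_sigma m (R : dsRingType m) (P : set R) :
  is_prime_ds_ideal P -> is_prime_ds_ideal [set f | P (ds_sigma f)].
Proof.
move=> [[[P0 PD PM] Pd Ps] [_ P1 Pp]].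
have Pi : is_ideal [set f | P (ds_sigma f)].
  split=> [|f g|a f] /=; first by rewrite rmorph0.
    by rewrite rmorphD; exact: PD.
  by rewrite rmorphM; exact: PM.
split; first split=> // [i|] f /=; first by rewrite -ds_delta_sigmaC; exact: Pd.
  exact: Ps.
by split=> //= [|f g]; [rewrite rmorph1 | rewrite rmorphM; exact: Pp].
Qed.

Lemma is_prime_ds_ideal_iter m (R : dsRingType m) (P : set R) k :
  is_prime_ds_ideal P -> is_prime_ds_ideal [set f | P (iter k ds_sigma f)].
Proof.
elim: k P => [//|k IHk] P Pp.
have := IHk _ (is_prime_ds_ideal_sigma Pp).
by congr is_prime_ds_ideal; apply: eq_set => f; rewrite iterS.
Qed.

(** * Regular ranks and their prolongation *)

Section DSGenerated.
Variables (m n : nat) (R : dsRingType m).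
Local Notation V := (dsop m * 'I_n)%type.
Variable x : V -> R.
Hypotheses (x_delta : forall a v, ds_delta a (x v) = x (var_delta a v))
  (x_sigma : forall v, ds_sigma (x v) = x (var_sigma v))
  (natR_unit : forall k, exists u : R, u * k.+1%:R = 1).
Local Notation gen := (subring_gen x).
Local Notation vranked := (ranked x (@var_lt m n)).
Local Notation below W v := [set w | W w /\ var_lt w v].

(** The Leibniz rule keeps undifferentiated factors, so [W'] must contain [W] along with its
    derivatives; in [gen_sigma] the shifted indeterminates suffice. *)
Lemma gen_delta C W W' a f : (forall c, C c -> C (ds_delta a c)) ->
  (forall w, W w -> W' w /\ W' (var_delta a w)) ->
  gen C W f -> gen C W' (ds_delta a f).
Proof.
move=> Cd WW'.
have gW g : gen C W g -> gen C W' g by apply: sgenS => w /WW'[].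
elim=> [c /Cd|v /WW'[_ v'W]||g h _ IHg _ IHh|g h Wg IHg Wh IHh].
- exact: sgen_base.
- by rewrite x_delta; exact: sgen_var.
- by rewrite (leibniz1 (ds_deltaM a)); exact: sgen0.
- by rewrite raddfB; exact: sgenB.
by rewrite ds_deltaM; apply: sgenD; apply: sgenM => //; exact: gW.
Qed.

Lemma gen_sigma C C' W W' f : (forall c, C c -> C' (ds_sigma c)) ->
  (forall w, W w -> W' (var_sigma w)) -> gen C W f -> gen C' W' (ds_sigma f).
Proof.
move=> Cs WW'; elim=> [c /Cs|v /WW' v'W||g h _ IHg _ IHh|g h _ IHg _ IHh].
- exact: sgen_base.
- by rewrite x_sigma; exact: sgen_var.
- by rewrite rmorph1; exact: sgen1.
- by rewrite rmorphB; exact: sgenB.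
by rewrite rmorphM; exact: sgenM.
Qed.

(* Requiring initial and separant to avoid the larger ideal [Q] is what makes
   prolongation by the derivations and by sigma possible inside [P]. *)
Definition regular_rank (C : set R) (W : set V) (P Q : set R) v d :=
  exists p, [/\ vranked C W v d p, P p.[x v], ~ Q p`_d & ~ Q p^`().[x v]].

Lemma regular_rank_le C W (P P' Q : set R) v d : P `<=` P' ->
  regular_rank C W P Q v d -> regular_rank C W P' Q v d.
Proof. by move=> PP' [p [rp /PP' Pp Qd Qs]]; exists p. Qed.

(** Multiply by a factor [x v + c] outside [Q]; modulo [Q] the new separant is the old one times
    that factor. *)
Lemma regular_rank_succ C W P Q v d :
  is_ideal P -> is_prime_ideal Q -> P `<=` Q ->
  regular_rank C W P Q v d -> regular_rank C W P Q v d.+1.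
Proof.
move=> [P0 PD PM] [[Q0 QD QM] Q1 Qp] PQ [p [[Wv sp Wp] Pp Qd Qs]].
(* A proper [Q] cannot contain both [x v] and [x v + 1], so [c] can be 0 or 1. *)
have [c [gc Qc]] : exists c : R, gen C (below W v) c /\ ~ Q (x v + c).
  have [Qv|Qv] := pselect (Q (x v)); last first.
    by exists 0; rewrite addr0; split=> //; exact: sgen0.
  exists 1; split; first exact: sgen1.
  move=> Qv1; apply: Q1; rewrite -[1](addKr (x v)) -mulN1r.
  by apply: QD => //; exact: QM.
exists (p * 'X + c *: p); split.
- split=> // [|i].
    rewrite (leq_trans (size_polyD _ _)) // geq_max.
    rewrite (leq_trans (size_polyMleq _ _)) ?size_polyX ?addn2 //=.
    by rewrite (leq_trans (size_scale_leq _ _)) // ltnW.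
  rewrite !coefE; apply: sgenD; last by apply: sgenM.
  by case: ifP => // _; exact: sgen0.
- rewrite !hornerE mulrC; apply: PD; exact: PM.
- rewrite !coefE /= [p`_d.+1]nth_default // mulr0 addr0; exact: Qd.
rewrite derivD derivM derivX derivZ !hornerE => Qs'.
have /Qp[//|//] : Q ((x v + c) * p^`().[x v]).
have -> : (x v + c) * p^`().[x v] =
    p^`().[x v] * x v + p.[x v] + c * p^`().[x v] + - 1 * p.[x v].
  by rewrite mulN1r mulrDl [x v * _]mulrC addrAC addrK.
by apply: QD => //; apply: QM; exact: PQ.
Qed.

(** If the separant lies in [Q], the derivative of [p] is a relation of lower degree whose initial,
    a positive integer multiple of the old one, still avoids [Q]; [regular_rank_succ] restores the
    degree. *)
Lemma ranked_regular C W Q v d p : is_prime_ideal Q -> vranked C W v d p ->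
  Q p.[x v] -> ~ Q p`_d -> regular_rank C W Q Q v d.
Proof.
move=> Qp; elim: d p => [|d IHd] p [Wv sp Wp] Qpv Qd.
  by move: Qpv; rewrite (size1_polyC sp) hornerC.
have [Qs|Qs] := pselect (Q p^`().[x v]); last by exists p.
apply: regular_rank_succ => //; first by case: Qp.
apply: (IHd p^`()) => //.
  split=> // [|i]; last by rewrite coef_deriv; apply: sgen_mulrn.
  apply/leq_sizeP => i lt_di; rewrite coef_deriv nth_default ?mul0rn //.
  exact: leq_trans sp _.
rewrite coef_deriv => Qd'; apply: Qd; have [u ud] := natR_unit d.
rewrite -[p`_d.+1]mul1r -ud -mulrA mulr_natl.
by apply: (idealMl (prime_ideal_ideal Qp)).
Qed.

(** By the chain rule the derivative of [p.[x v]] is linear in the derivative of the leader, with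
    initial and separant both equal to the separant of [p]. *)
Lemma regular_rank_delta C W P Q a v d :
  (forall c, C c -> C (ds_delta a c)) -> (forall w, W w -> W (var_delta a w)) ->
  (forall f, P f -> P (ds_delta a f)) ->
  is_ideal P -> is_prime_ideal Q -> P `<=` Q ->
  regular_rank C W P Q v d -> regular_rank C W P Q (var_delta a v) d.
Proof.
move=> Cd Wd Pd Pi Qp PQ [p [[Wv sp Wp] Pp Qd Qs]].
have v_lt := var_lt_delta a v.
have gS g : gen C (below W v) g -> gen C (below W (var_delta a v)) g.
  by apply: sgenS => w [Ww wv]; split=> //; exact: var_lt_trans v_lt.
have gv : gen C (below W (var_delta a v)) (x v) by exact: sgen_var.
have gs : gen C (below W (var_delta a v)) p^`().[x v].
  by apply: sgen_horner => // i; rewrite coef_deriv; apply: sgen_mulrn; exact: gS.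
have gd : gen C (below W (var_delta a v)) (map_poly (ds_delta a) p).[x v].
  apply: sgen_horner => // i; rewrite coef_map; apply: gen_delta (Wp i) => //.
  move=> w [Ww wv]; split; split=> //; [|exact: Wd|exact: var_delta_lt].
  exact: var_lt_trans v_lt.
have r1 : regular_rank C W P Q (var_delta a v) 1.
  exists (p^`().[x v] *: 'X + (map_poly (ds_delta a) p).[x v]%:P); split.
  - split=> [||i]; first exact: Wd.
      rewrite (leq_trans (size_polyD _ _)) // geq_max.
      rewrite (leq_trans (size_scale_leq _ _)) ?size_polyX //.
      by rewrite (leq_trans (size_polyC_leq1 _)).
    rewrite !coefE; apply: sgenD; last by case: ifP => // _; exact: sgen0.
    by apply: sgenM => //; case: eqP => _; [exact: sgen1|exact: sgen0].
  - rewrite !hornerE -x_delta addrC -(delta_horner (ds_deltaM a)).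
    exact: Pd.
  - by rewrite !coefE /= mulr1 addr0.
  by rewrite derivD derivZ derivX derivC !hornerE.
(* In degree 0 the element equals its own initial, which would then lie in [Q]. *)
have d_gt0 : (0 < d)%N.
  case: d sp Qd {Wp} => // sp; case; apply: PQ; move: Pp.
  by rewrite (size1_polyC sp) hornerC coefC.
rewrite -(subnK d_gt0) addn1; elim: (d - 1)%N => // e IHe.
exact: regular_rank_succ.
Qed.

(** Applying sigma to the coefficients applies it to initial and separant, and reflexivity keeps
    these outside [Q]. *)
Lemma regular_rank_sigma C C' W W' (P P' Q : set R) v d :
  (forall c, C c -> C' (ds_sigma c)) -> (forall w, W w -> W' (var_sigma w)) ->
  (forall f, P f -> P' (ds_sigma f)) -> (forall f, Q (ds_sigma f) -> Q f) ->
  regular_rank C W P Q v d -> regular_rank C' W' P' Q (var_sigma v) d.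
Proof.
move=> Cs Ws Ps Qs [p [[Wv sp Wp] Pp Qd Qsp]].
exists (map_poly ds_sigma p); split.
- split=> [||i]; first exact: Ws.
    exact: leq_trans (size_poly _ _) sp.
  rewrite coef_map; apply: gen_sigma (Wp i) => // w [/Ws Ww wv].
  by split=> //; exact: var_sigma_lt.
- by rewrite -x_sigma horner_map; exact: Ps.
- by rewrite coef_map => /Qs.
by rewrite deriv_map -x_sigma horner_map => /Qs.
Qed.

Lemma regular_rank_sub C W (P Q : set R) :
  is_prime_ideal P -> is_prime_ideal Q -> P `<=` Q ->
  gen C set0 `&` Q `<=` P ->
  (forall v d, regular_rank C W Q Q v d -> regular_rank C W P Q v d) ->
  gen C W `&` Q `<=` P.
Proof.
move=> Pp Qp PQ CQP QP.
apply: (ranked_prime_sub (@var_lt_wf m n) (@var_lt_trans m n)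
  (@var_lt_total m n)) => // v d p rp Qpv Qd.
by have [q [? ? ? _]] := QP v d (ranked_regular Qp rp Qpv Qd); exists q.
Qed.

Lemma regular_rank_bigcup C W (P : nat -> set R) Q v d :
  Q `<=` [set f | exists i, P i f] ->
  regular_rank C W Q Q v d -> exists i, regular_rank C W (P i) Q v d.
Proof. by move=> QP [p [rp /QP[i Pi] Qd Qs]]; exists i, p. Qed.

(** * Stabilisation of chains over a ground field *)

Variable C0 : set R.
Hypotheses (C0_delta : forall a c, C0 c -> C0 (ds_delta a c))
  (C0_sigma : forall c, C0 c -> C0 (ds_sigma c))
  (C0_field : forall c, gen C0 set0 c -> c = 0 \/ exists u, u * c = 1)
  (genT : forall f, gen C0 setT f).

(** A proper ideal contains no unit, so the only element of [Q] over [C0] alone is 0. *)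
Lemma field_ideal_sub (P Q : set R) :
  is_ideal P -> is_prime_ideal Q -> gen C0 set0 `&` Q `<=` P.
Proof.
move=> [P0 _ _] [[_ _ QM] Q1 _] c [/C0_field[-> //|[u uc]] Qc].
by case: Q1; rewrite -uc; exact: QM.
Qed.

(** Regular ranks relative to the union are stable under all operators, so [var_chain] applies; each
    rank of the union is witnessed in a single [P i]. *)
Lemma reflexive_chain_stable (P : nat -> set R) :
  (forall i, is_prime_ds_ideal (P i)) -> (forall i, P i `<=` P i.+1) ->
  (forall f, (exists i, P i (ds_sigma f)) -> exists i, P i f) ->
  exists i0, [set f | exists i, P i f] `<=` P i0.
Proof.
move=> Pp P_le Prefl; set Q := [set f | exists i, P i f].
have Qp : is_prime_ideal Q.
  by apply: is_prime_ideal_bigcup => // i; case: (Pp i).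
have PQ i : P i `<=` Q by move=> f; exists i.
have Pi i : is_ideal (P i) by case: (Pp i) => -[].
have [|i v d|i v a d|i v d|i0 i0P] :=
  @var_chain m n (fun i => regular_rank C0 setT (P i) Q).
- by move=> i v d; apply: regular_rank_le.
- exact: regular_rank_succ.
- apply: regular_rank_delta => //; first exact: C0_delta.
  by case: (Pp i) => -[_ Pd _] _; exact: Pd.
- by apply: regular_rank_sigma => //; case: (Pp i) => -[].
exists i0 => f Qf; apply: (@regular_rank_sub C0 setT _ Q) => //.
- by case: (Pp i0).
- exact: field_ideal_sub.
by move=> v d /(@regular_rank_bigcup _ _ P)[//|i]; exact: i0P.
Qed.

Local Notation above s := [set v : V | (s <= v.1.2)%N].

(** Each application of sigma moves the leader and the smaller indeterminates up one level, whence
    the bound [k + s]. *)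
Lemma regular_rank_sigma_iter k s (P Q : set R) v d :
  (forall f, Q (ds_sigma f) -> Q f) ->
  regular_rank C0 (above s) [set f | P (iter k ds_sigma f)] Q v d ->
  regular_rank C0 (above (k + s)) P Q (iter k (@var_sigma m n) v) d.
Proof.
move=> Qrefl; elim: k s v => [//|k IHk] s v rv.
rewrite iterSr addSnnS; apply: IHk.
apply: regular_rank_sigma rv => // f /=; by rewrite -iterSr.
Qed.

(* The shifted rank sets over the levels >= s increase with s, so that from
   some level on every regular rank of [Q] is a [sigma^k]-image of one. *)
Lemma high_levels_sub k (Q : set R) : is_prime_ds_ideal Q ->
  (forall f, Q (ds_sigma f) -> Q f) ->
  exists s0, forall P, is_prime_ideal P -> P `<=` Q ->
    (forall f, Q f -> P (iter k ds_sigma f)) -> gen C0 (above s0) `&` Q `<=` P.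
Proof.
move=> [[Qi Qd Qs] Qp] Qrefl.
(* Levels are counted from [s], so that applying sigma embeds [S s] into [S s.+1]. *)
pose S s v d := regular_rank C0 (above s) Q Q (iter s (@var_sigma m n) v) d.
have sS s v d : S s v d -> S s.+1 v d by apply: regular_rank_sigma.
have [//|s v d|s v a d|s v d|s1 s1P] := @var_chain m n S.
- exact: regular_rank_succ.
- rewrite /S; have -> : iter s (@var_sigma m n) (var_delta a v) =
      var_delta a (iter s (@var_sigma m n) v) by rewrite !iter_var_sigma.
  by apply: regular_rank_delta => //; [exact: C0_delta | exact: Qd].
- rewrite /S -iterSr iterS; apply: regular_rank_sigma => // w /= /leq_trans; exact.
(* A leader of level at least [k + s1] is the shift of some [w] by [k + s1]. By stabilisation the
   shift of [w] by [s1] already leads a relation in [Q], and [k] more applications of sigma carry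
   that relation into [P]. *)
exists (k + s1)%N => P Pp PQ QP; apply: regular_rank_sub => //.
  by apply: field_ideal_sub => //; case: Pp.
move=> v d rv; have [_ [[/= le_v _ _] _ _ _]] := rv.
pose w : V := ((v.1.1, v.1.2 - (k + s1))%N, v.2).
have vE : v = iter (k + s1) (@var_sigma m n) w.
  by rewrite iter_var_sigma /= subnKC //; case: (v) => -[].
have := s1P (k + s1)%N w d; rewrite /S -vE => /(_ rv) rw.
rewrite vE iterD; apply: regular_rank_sigma_iter => //.
exact: regular_rank_le rw.
Qed.

(** The high levels act as coefficients, where the chain already agrees with its union; finitely
    many sigma-orders remain below [s0], so [var_chain_level] applies. *)
Lemma level_chain_stable s0 (P : nat -> set R) :
  (forall i, is_prime_ds_ideal (P i)) -> (forall i, P i `<=` P i.+1) ->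
  (forall i, gen C0 (above s0) `&` [set f | exists i, P i f] `<=` P i) ->
  exists i0, [set f | exists i, P i f] `<=` P i0.
Proof.
move=> Pp P_le CQP; set Q := [set f | exists i, P i f] in CQP *.
have Qp : is_prime_ideal Q.
  by apply: is_prime_ideal_bigcup => // i; case: (Pp i).
have PQ i : P i `<=` Q by move=> f; exists i.
have Pi i : is_ideal (P i) by case: (Pp i) => -[].
pose C := gen C0 (above s0); pose W := [set v : V | (v.1.2 < s0)%N].
have [|i v d|i v a d|i0 i0P] :=
  @var_chain_level m n (fun i => regular_rank C W (P i) Q) _ _ _ s0.
- by move=> i v d; apply: regular_rank_le.
- exact: regular_rank_succ.
- apply: regular_rank_delta => //; last by case: (Pp i) => -[_ Pd _] _; exact: Pd.
  by move=> c; apply: gen_delta => //; exact: C0_delta.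
exists i0 => f Qf; apply: (@regular_rank_sub C W _ Q) => //.
- by case: (Pp i0).
- move=> g [Cg Qg]; apply: CQP; split=> //; exact: sgen_sub Cg.
- move=> v d rv; have [i ri] := @regular_rank_bigcup _ _ P _ _ _ (fun f => id) rv.
  by apply: i0P (ri); case: rv => p [[]].
split=> //; apply: sgen_sub (genT f) => [c Cc|v _].
  by apply: sgen_base; exact: sgen_base.
have [lt_v|le_v] := ltnP v.1.2 s0; first exact: sgen_var.
by apply: sgen_base; exact: sgen_var.
Qed.

Lemma prime_ds_chain_stable (P : nat -> set R) :
  (forall i, is_prime_ds_ideal (P i)) -> (forall i, P i `<=` P i.+1) ->
  exists j, forall k, (j <= k)%N -> P k = P j.
Proof.
move=> Pp P_le; pose U := [set f | exists i, P i f].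
have Up : is_prime_ds_ideal U by exact: is_ds_ideal_bigcup.
have Us f : U f -> U (ds_sigma f) by case: Up => -[_ _ Us] _; exact: Us.
pose T k := [set f | U (iter k ds_sigma f)].
have T_le k : T k `<=` T k.+1 by move=> f /Us.
pose Q := [set f | exists k, T k f].
have Qp : is_prime_ds_ideal Q.
  by apply: is_ds_ideal_bigcup => // k; exact: is_prime_ds_ideal_iter.
have Qrefl f : Q (ds_sigma f) -> Q f.
  by move=> [k Tk]; exists k.+1; rewrite /T /= -iterS iterSr.
have [k|//|//|k0 QT] := @reflexive_chain_stable T.
  exact: is_prime_ds_ideal_iter.
(* The union of this chain is [T k0], which equals the reflexive [Q]. *)
have [|//|f|i1 QP] := @reflexive_chain_stable
    (fun i => [set f | P i (iter k0 ds_sigma f)]).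
- by move=> i; exact: is_prime_ds_ideal_iter.
- by move=> i f /P_le.
- by move=> [i Pf]; apply: (QT f); apply: Qrefl; exists k0; exists i.
have PQ i : P i `<=` Q by move=> f Pf; exists 0%N; exists i.
have [s0 s0P] := high_levels_sub k0 Qp Qrefl.
(* The chain restarts at [i1], from where each member contains the image of [Q] under [k0]
   applications of sigma. *)
have [|i|i|i0 i0P] := @level_chain_stable s0 (fun i => P (i1 + i)%N).
- by [].
- by rewrite addnS.
- move=> f [gf [j Pf]]; apply: s0P; [by case: (Pp (i1 + i)%N)|exact: PQ| |].
    move=> g /QT[j' Pg]; apply: (stable_le P_le (leq_addr i i1)).
    by apply: QP; exists j'.
  by split=> //; exact: PQ Pf.
exists (i1 + i0)%N => k le_k; apply/seteqP; split; last exact: stable_le.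
move=> f Pf; apply: i0P; exists k.
by apply: stable_le Pf => //; exact: leq_addl.
Qed.

End DSGenerated.

(** * Application to difference-differential polynomials *)

Section DSPolyGenerated.
Variables (m n : nat) (K : dsFieldType m).
Local Notation R := {dspoly K[n]}%type.

Definition dspoly_var (v : dsop m * 'I_n) : R := dspolyX K v.1 v.2.

HB.instance Definition _ := GRing.RMorphism.copy (@dspolyC m n K)
  (@malgC {cmonom (dsop m * 'I_n)%type} K).

Lemma dspolyC_range (c : R) :
  subring_gen dspoly_var (range (@dspolyC m n K)) set0 c ->
  exists a, c = dspolyC n a.
Proof.
elim=> [_ [a _ <-]|//||f g _ [a ->] _ [b ->]|f g _ [a ->] _ [b ->]].
- by exists a.
- by exists 1; rewrite rmorph1.
- by exists (a - b); rewrite rmorphB.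
by exists (a * b); rewrite rmorphM.
Qed.

Lemma dspoly_gen (f : R) :
  subring_gen dspoly_var (range (@dspolyC m n K)) setT f.
Proof.
elim/dspoly_ind: f => [c|t j|f g|f g].
- by apply: sgen_base; exists c.
- exact: (@sgen_var _ _ dspoly_var _ setT (t, j)).
- exact: sgenD.
- exact: sgenM.
Qed.

Lemma dspoly_chain_stable (P : nat -> set R) : [pchar K] =i pred0 ->
  (forall i, is_prime_ds_ideal (P i)) -> (forall i, P i `<=` P i.+1) ->
  exists j, forall k, (j <= k)%N -> P k = P j.
Proof.
move=> K0; apply: (@prime_ds_chain_stable m n R dspoly_var _ _ _
  (range (@dspolyC m n K))).
- by move=> a v; exact: dspoly_deltaEX.
- by move=> v; exact: dspoly_sigmaEX.
(* Characteristic zero makes [k + 1] invertible in [K], hence in the polynomial ring. *)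
- move=> k; exists (dspolyC n k.+1%:R^-1); rewrite -(rmorph_nat (@dspolyC m n K)).
  rewrite -rmorphM mulVf ?rmorph1 //.
  by move/pcharf0P: K0 => ->.
- move=> a _ [c _ <-]; exists (ds_delta a c) => //.
  by symmetry; exact: dspoly_deltaEC.
- move=> _ [c _ <-]; exists (ds_sigma c) => //.
  by symmetry; exact: dspoly_sigmaEC.
- move=> c /dspolyC_range[a ->]; have [->|a_neq0] := eqVneq a 0.
    by left; rewrite rmorph0.
  by right; exists (dspolyC n a^-1); rewrite -rmorphM mulVf ?rmorph1.
exact: dspoly_gen.
Qed.

End DSPolyGenerated.

Theorem corollary4p5 :
  (forall (m n : nat) (K : dsFieldType m), [pchar K] =i pred0 ->
   forall P : nat -> set {dspoly K[n]},
     (forall i : nat, is_prime_ds_ideal (P i)) ->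
     (forall i : nat, P i `<=` P i.+1) ->
     exists j : nat, forall k : nat, (j <= k)%N -> P k = P j)
  /\
  (forall (n : nat) (K : diffFieldType), [pchar K] =i pred0 ->
   forall P : nat -> set {dspoly K[n]},
     (forall i : nat, is_prime_ds_ideal (P i)) ->
     (forall i : nat, P i `<=` P i.+1) ->
     exists j : nat, forall k : nat, (j <= k)%N -> P k = P j).
Proof.
by split=> [m n K K0 P|n K K0 P]; exact: dspoly_chain_stable.
Qed.
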